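(* Let $X_1, \ldots, X_n$ be independent sub-uniform random variables and $\bar X_n=n^{-1} \sum_{i=1}^n X_i$. Then for $0 \leq t \leq 1/2$, $$\mathrm{P}\left(1/2 - \bar X_n\geq t\right) \leq \min_{h\geq 0}\left\{2 e^{-h t} \sinh(h/2)/h\right\}^n \leq \exp(-12 n t^2) \left\{\sinh(6 t)/(6t)\right\}^n \leq \exp(-6 n t^2),$$ where $\sinh(ax)/(bx)$ at $x=0$ is interpreted as its limit $a/b$ (so $2\sinh(h/2)/h=1$ at $h=0$ and $\sinh(6t)/(6t)=1$ at $t=0$).
   Context: A random variable $X$ is sub-uniform if it is dominated in the convex order by a uniform random variable $U$ on $[0,1]$: $\mathrm{E}\{g(X)\}\le\mathrm{E}\{g(U)\}$ for every convex $g:\mathbb{R}\to\mathbb{R}$ for which the expectations exist.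
   Formalization: The minimum over h ≥ 0 is stated as an infimum, because at t = 1/2 the function (1−e^{−h})/h decreases to 0 and no minimum exists; for t < 1/2 the infimum is the minimum, though its attainment is not asserted. *)

(* Defs.v *)
From HB Require Import structures.
From mathcomp Require Import all_boot all_order all_algebra.
From mathcomp Require Import all_classical all_reals all_analysis.
Set Implicit Arguments. Unset Strict Implicit. Unset Printing Implicit Defensive.
Import Order.TTheory GRing.Theory Num.Theory.
Import numFieldNormedType.Exports.
Local Open Scope classical_set_scope.
Local Open Scope ring_scope.

Definition sinh (R : realType) (x : R) : R := (expR x - expR (- x)) / 2.

Definition convexR (R : realType) (g : R -> R) : Prop :=
  convex_function (E := R^o) setT g.

(* The expectation of Y exists (in the extended sense): not of the
   form +oo - +oo, i.e. the positive or the negative part has finite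
   integral. *)
Definition expectation_exists d (T : measurableType d) (R : realType)
    (mu : {measure set T -> \bar R}) (D : set T) (Y : T -> R) : Prop :=
  ((\int[mu]_(w in D) ((EFin \o Y)^\+ w) < +oo)%E \/
   (\int[mu]_(w in D) ((EFin \o Y)^\- w) < +oo)%E).

(* X is sub-uniform: dominated in the convex order by U ~ Uniform[0,1]:
   E g(X) <= E g(U) = \int_0^1 g(u) du for every convex g for which the
   expectations exist. *)
Definition sub_uniform d (T : measurableType d) (R : realType)
    (P : probability T R) (X : {RV P >-> R}) : Prop :=
  forall g : R -> R, convexR g ->
    expectation_exists P setT (g \o X) ->
    expectation_exists (@lebesgue_measure R) `[0%R, 1%R] g ->
    ('E_P[g \o X] <= \int[lebesgue_measure]_(u in `[0%R, 1%R]) (g u)%:E)%E.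

Definition mutually_independent d (T : measurableType d) (R : realType)
    (P : probability T R) (n : nat) (X : 'I_n -> {RV P >-> R}) : Prop :=
  forall (J : {set 'I_n}) (B : 'I_n -> set R),
    (forall i, measurable (B i)) ->
    P (\bigcap_(i in [set j | j \in J]) (X i @^-1` B i)) =
      (\prod_(i in J) P (X i @^-1` B i))%E.

Definition bound_fun (R : realType) (t h : R) : R :=
  if h == 0 then 1 else 2 * expR (- (h * t)) * sinh (h / 2) / h.

Definition sinhc6 (R : realType) (t : R) : R :=
  if t == 0 then 1 else sinh (6 * t) / (6 * t).

(* Main.v *)
Require Import Defs.
From HB Require Import structures.
From mathcomp Require Import all_boot all_order all_algebra.
From mathcomp Require Import all_classical all_reals all_analysis.
From mathcomp Require Import measurable_realfun zify ring lra.
Import Order.TTheory GRing.Theory Num.Theory.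
Import numFieldNormedType.Exports.
Import HBNNSimple.
Local Open Scope classical_set_scope.
Local Open Scope ring_scope.

(* Chernoff's bound for - sum X_i: since x |-> exp (- h x) is convex, each factor
   E exp (- h X_i) is at most int_0^1 exp (- h u) du = (1 - exp (- h)) / h, and
   independence turns these into the n-th power of the bound function.  Its value
   at h = 12 t gives the second bound; the third is sinh x / x <= exp (x^2 / 6),
   which compares power series termwise through 6^k k! <= (2k+1)!. *)

(** * Power series comparison for the hyperbolic sine *)

Lemma fact_odd_ge (k : nat) : (6 ^ k * k`! <= (k * 2).+1`!)%N.
Proof.
elim: k => // k IH; rewrite mulSn !addSn add0n expnS !factS.
rewrite [leqLHS](_ : _ = 6 * k.+1 * (6 ^ k * k`!))%N; last by ring.
(* The new factor (2k+3)(2k+2) on the right dominates the new factor 6(k+1) on the left. *)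
by rewrite [leqRHS]mulnA leq_mul//; nia.
Qed.

Lemma sinh_le (R : realType) (x : R) : 0 <= x -> sinh x <= x * expR (x ^+ 2 / 6).
Proof.
move=> x0.
(* Truncating both exponential series at the even length 2n leaves exactly the n odd terms x, ...,
   x^(2n-1)/(2n-1)!, so going from [n] to [n.+1] adds a single term. *)
pose u n := (series (exp_coeff x) (n * 2)%N - series (exp_coeff (- x)) (n * 2)%N) / 2.
have cvgu : u n @[n --> \oo] --> sinh x.
  have cvg2 y : series (exp_coeff y) (n * 2)%N @[n --> \oo] --> expR y.
    apply: (cvg_comp (muln^~ 2%N)); first exact: cvg_mulnr.
    exact: is_cvg_series_exp_coeff.
  by apply: cvgMr_tmp; apply: cvgB; apply: cvg2.
have uE n : u n <= x * series (exp_coeff (x ^+ 2 / 6)) n.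
  elim: n => [|n IH]; first by rewrite /u /series/= !big_nil subrr mul0r mulr0.
  have -> : u n.+1 = u n + x ^+ (n * 2).+1 / (n * 2).+1`!%:R.
    have xN : (- x) ^+ (n * 2) = x ^+ (n * 2) by rewrite mulnC !exprM sqrrN.
    rewrite /u /series /exp_coeff /= mulSn !big_nat_recr//= !exprS xN; field.
    by rewrite !pnatr_eq0 -!lt0n !fact_gt0.
  rewrite /series /= big_nat_recr//= mulrDr lerD//.
  rewrite /exp_coeff/= exprS -mulrA ler_wpM2l// exprMn exprVn (mulnC n) exprM -mulrA.
  rewrite ler_wpM2l ?exprn_ge0 ?sqr_ge0// -invfM lef_pV2 ?posrE.
  - by rewrite -natrX -natrM ler_nat (mulnC 2%N) fact_odd_ge.
  - by rewrite ltr0n fact_gt0.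
  - by rewrite mulr_gt0 ?exprn_gt0// ltr0n fact_gt0.
rewrite -(cvg_lim _ cvgu)//; apply: limr_le; first exact: cvgP cvgu.
(* The terms at x^2/6 are nonnegative, so each partial sum stays below the exponential. *)
apply: nearW => n; apply: le_trans (uE n) _; rewrite ler_wpM2l//.
apply: nondecreasing_cvgn_le; last exact: is_cvg_series_exp_coeff.
apply: nondecreasing_series => k _ _; apply: exp_coeff_ge0.
by rewrite divr_ge0 ?sqr_ge0.
Qed.

(** * Exponential moments of a sub-uniform variable *)

Lemma expR_integral01 (R : realType) (h : R) : h != 0 ->
  (\int[@lebesgue_measure R]_(u in `[0%R, 1%R]) (expR (- h * u))%:E =
   ((1 - expR (- h)) / h)%:E)%E.
Proof.
move=> h0; pose F (u : R) := - (expR (- h * u) / h).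
have dF (u : R) : is_derive u 1 F (expR (- h * u)).
  have dl : is_derive u 1 (fun v : R => - h * v) (- h).
    by apply: is_derive_eq; rewrite scaler1.
  have de : is_derive u 1 (expR \o (fun v : R => - h * v)) (expR (- h * u) * - h).
    exact: is_derive1_comp.
  rewrite /F; apply: is_derive_eq.
  by rewrite scaler0 add0r -[LHS]/(- (h^-1 * (expR (- h * u) * - h))); field.
have cF : continuous F.
  by move=> u; apply/differentiable_continuous/derivable1_diffP; case: (dF u).
rewrite (@continuous_FTC2 _ _ F)//.
- by rewrite /F mulr1 mulr0 expR0 -EFinB; congr EFin; field.
- apply: continuous_subspaceT => u.
  apply: continuous_comp; last exact: continuous_expR.
  exact: mulrl_continuous.
- split.
  + by move=> u _; case: (dF u).
  + exact/cvg_at_right_filter/cF.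
  + exact/cvg_at_left_filter/cF.
- by move=> u _; rewrite derive1E; apply: derive_val.
Qed.

Local Open Scope convex_scope.

Lemma sub_uniform_mgf_le d (T : measurableType d) (R : realType)
    (P : probability T R) (X : {RV P >-> R}) (h : R) : h != 0 ->
  sub_uniform X ->
  (\int[P]_w (expR (- h * X w))%:E <= ((1 - expR (- h)) / h)%:E)%E.
Proof.
move=> h0 subX; pose g (u : R) := expR (- h * u).
(* An exponential has zero negative part, so both existence conditions in [sub_uniform] hold, for
   [P] and for Lebesgue measure alike. *)
have exg d' (T' : measurableType d') (mu : {measure set T' -> \bar R}) D (f : T' -> R) :
    expectation_exists mu D (fun w => expR (f w)).
  right; rewrite integral0_eq ?ltry// => w _.
  by rewrite (@ge0_funenegE _ _ setT) ?inE// => v _; rewrite lee_fin expR_ge0.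
have := subX g _ (exg _ _ _ _ _) (exg _ _ _ _ _).
rewrite expR_integral01// unlock; apply.
move=> t x y _ _; rewrite /g.
have -> : - h * (x <| t |> y) = ((- h * x : R^o) <| t |> (- h * y : R^o)).
  by rewrite !convRE/= mulrDr !mulrA !(mulrC (- h)) -!mulrA.
exact: convex_expR.
Qed.

Local Close Scope convex_scope.

(** * Independence and integrals of products *)

(** The standard extension from indicators: linearity gives simple functions, monotone convergence
    gives nonnegative measurable ones. It serves to replace one factor of a product, with [Z] the
    product of the other factors and [c] the product of their integrals. *)
Lemma ge0_integral_compM d d' (T : measurableType d) (U : measurableType d')
    (R : realType) (mu : {measure set T -> \bar R}) (X : T -> U) (Z : T -> R)
    (c : R) :
  measurable_fun setT X -> measurable_fun setT Z -> (forall w, 0 <= Z w) ->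
  0 <= c ->
  (forall B, measurable B ->
    \int[mu]_w (\1_B (X w) * Z w)%:E = c%:E * \int[mu]_w (\1_B (X w))%:E)%E ->
  forall g : U -> R, measurable_fun setT g -> (forall u, 0 <= g u) ->
  (\int[mu]_w (g (X w) * Z w)%:E = c%:E * \int[mu]_w (g (X w))%:E)%E.
Proof.
move=> mX mZ Z0 c0 indicH g mg g0.
have nnsfunH (h : {nnsfun U >-> R}) :
    (\int[mu]_w (h (X w) * Z w)%:E = c%:E * \int[mu]_w (h (X w))%:E)%E.
  pose I r u : R := \1_(h @^-1` [set r]) u.
  have mI r : measurable_fun setT (fun w => I r (X w)).
    apply: (@measurableT_comp _ _ _ _ _ _ (I r)) mX; apply: measurable_indic.
    exact: measurable_funPTI.
  have rI0 r u : 0 <= r * I r u.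
    by have := nnfun_muleindic_ge0 h r u; rewrite -EFinM lee_fin.
  have termH r :
      (\int[mu]_w (r * I r (X w) * Z w)%:E = c%:E * \int[mu]_w (r * I r (X w))%:E)%E.
    (* For negative [r] the level set of the nonnegative [h] is empty and both sides vanish;
       otherwise the scalar [r] can be pulled out. *)
    have [r0|r0] := ltP r 0.
      have I0 w : I r (X w) = 0 by rewrite /I preimage_nnfun0// indic0.
      by rewrite !integral0_eq ?mule0// => w _; rewrite I0 ?mulr0 ?mul0r.
    under eq_integral do rewrite -mulrA EFinM.
    under [in RHS]eq_integral do rewrite EFinM.
    rewrite !ge0_integralZl_EFin//.
    - by rewrite indicH// muleCA.
    - by move=> w _; rewrite lee_fin /I indicE.
    - exact/measurable_EFinP.
    - by move=> w _; rewrite lee_fin mulr_ge0// /I indicE.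
    - exact/measurable_EFinP/measurable_funM.
  have hE u : (h u)%:E = (\sum_(r \in range h) (r * I r u)%:E)%E.
    by rewrite {1}(fimfunE h) -fsumEFin.
  have hZE w : (h (X w) * Z w)%:E =
      (\sum_(r \in range h) (r * I r (X w) * Z w)%:E)%E.
    by rewrite EFinM hE ge0_mule_fsuml// => r; rewrite lee_fin.
  under eq_integral do rewrite hZE.
  rewrite ge0_integral_fsum//; last 2 first.
  - by move=> r; apply/measurable_EFinP; do 2 apply: measurable_funM => //.
  - by move=> r w _; rewrite lee_fin mulr_ge0.
  under [in RHS]eq_integral do rewrite hE.
  rewrite ge0_integral_fsum//; last 2 first.
  - by move=> r; apply/measurable_EFinP; apply: measurable_funM.
  - by move=> r w _; rewrite lee_fin.
  rewrite ge0_mule_fsumr; last by move=> r; apply: integral_ge0 => w _; rewrite lee_fin.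
  by apply: eq_fsbigr => r _; exact: termH.
have mgE : measurable_fun setT (EFin \o g) by exact/measurable_EFinP.
pose h := nnsfun_approx measurableT mgE.
have mh k : measurable_fun setT (fun w => h k (X w)).
  exact: (measurableT_comp (measurable_funPT (h k))).
have hg u : (h n u)%:E @[n --> \oo] --> (g u)%:E.
  by apply: (cvg_nnsfun_approx measurableT mgE) => // v _; rewrite lee_fin.
have ndh u m n : (m <= n)%N -> h m u <= h n u.
  by move=> mn; exact/lefP/nd_nnsfun_approx.
(* Monotone convergence is applied to both sides along simple functions increasing to [g]. *)
transitivity (limn (fun n => \int[mu]_w (h n (X w) * Z w)%:E))%E.
  rewrite -monotone_convergence//.
  - apply: eq_integral => w _; apply/esym/cvg_lim => //.
    by under eq_fun do rewrite EFinM; rewrite EFinM; apply: cvgeZr.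
  - by move=> n; apply/measurable_EFinP/measurable_funM.
  - by move=> n w _; rewrite lee_fin mulr_ge0.
  - by move=> w _ m n mn; rewrite lee_fin ler_wpM2r// ndh.
transitivity (limn (fun n => c%:E * \int[mu]_w (h n (X w))%:E))%E.
  by congr (limn _); apply/funext => n; exact: nnsfunH.
rewrite limeMl//; last first.
  apply: ereal_nondecreasing_is_cvgn => m n mn; apply: ge0_le_integral => //.
  - by move=> w _; rewrite lee_fin.
  - exact/measurable_EFinP.
  - exact/measurable_EFinP.
  - by move=> w _; rewrite lee_fin ndh.
congr (_ * _)%E; rewrite -monotone_convergence//.
- by apply: eq_integral => w _; apply/cvg_lim.
- by move=> n; apply/measurable_EFinP.
- by move=> n w _; rewrite lee_fin.
- by move=> w _ m n mn; rewrite lee_fin ndh.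
Qed.

(* Induction on the number of factors that are not indicator functions: one of
   them is generalized at a time, the others forming the weight [Z] of
   [ge0_integral_compM]. *)
Lemma indep_integral_prod d (T : measurableType d) (R : realType)
    (P : probability T R) (n : nat) (X : 'I_n -> {RV P >-> R}) (g : 'I_n -> R -> R) :
  mutually_independent X ->
  (forall i, measurable_fun setT (g i)) -> (forall i x, 0 <= g i x) ->
  (forall i, (\int[P]_w (g i (X i w))%:E)%E \is a fin_num) ->
  (\int[P]_w (\prod_(i < n) g i (X i w))%:E =
   \prod_(i < n) \int[P]_w (g i (X i w))%:E)%E.
Proof.
move=> indX mg g0 fing.
have main k : forall g : 'I_n -> R -> R,
    (forall i, measurable_fun setT (g i)) -> (forall i x, 0 <= g i x) ->
    (forall i, (\int[P]_w (g i (X i w))%:E)%E \is a fin_num) ->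
    (forall i : 'I_n, (k <= i)%N -> exists2 B, measurable B & g i = \1_B) ->
    (\int[P]_w (\prod_(i < n) g i (X i w))%:E =
     \prod_(i < n) \int[P]_w (g i (X i w))%:E)%E.
  elim: k => [|k IH] {mg g0 fing}g mg g0 fing gB.
    have /choice[B gE] i : exists B : set R, measurable B /\ g i = \1_B.
      by have [B] := gB i (leq0n _); exists B.
    have mXB i : measurable (X i @^-1` B i) by apply: measurable_funPTI; case: (gE i).
    (* When all factors are indicators, their product is the indicator of the intersection [A], and
       independence for the full index set factorizes its probability. *)
    have := indX [set: 'I_n]%SET B (fun i => (gE i).1).
    rewrite (eq_bigl xpredT); last by move=> i; rewrite inE.
    set A := \bigcap_(i in _) _ => PA.
    have mA : measurable A by apply: fin_bigcap_measurable.
    transitivity (\int[P]_w (\1_A w)%:E)%E.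
      apply: eq_integral => w _; congr EFin; rewrite indicE.
      have [Aw|nAw] := boolP (w \in A).
        rewrite big1// => i _; rewrite (gE i).2 indicE mem_set//.
        by apply: (set_mem Aw) => /=; rewrite inE.
      have [[i Bi]|nB] := pselect (exists i, ~ B i (X i w)).
        by rewrite (bigD1 i)//= (gE i).2 indicE memNset// mul0r.
      case/negP: nAw; apply/mem_set => i _ /=.
      by apply: contrapT => Bi; apply: nB; exists i.
    rewrite integral_indic// setIT; apply: (eq_trans PA); apply: eq_bigr => i _.
    rewrite (gE i).2 -[in LHS](setIT (X i @^-1` B i)) -integral_indic//.
  (* For k >= n no index reaches [k], so the condition on indicators is vacuous and the induction
     hypothesis applies directly. *)
  have [kn|nk] := ltnP k n; last first.
    by apply: IH => // i ki; move: (ltn_ord i); rewrite ltnNge (leq_trans nk).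
  pose i0 := Ordinal kn.
  have mgX i : measurable_fun setT (fun w => g i (X i w)) by exact: measurableT_comp.
  (* Finiteness of this product lets it act as the real constant [c] of [ge0_integral_compM]. *)
  have prod_fin : (\prod_(i < n | i != i0) \int[P]_w (g i (X i w))%:E)%E \is a fin_num.
    exact: prode_fin_num.
  rewrite (bigD1 i0)//= muleC -(fineK prod_fin).
  under eq_integral do rewrite (bigD1 i0)//=.
  apply: (@ge0_integral_compM _ _ _ _ _ P (X i0)
    (fun w => \prod_(i < n | i != i0) g i (X i w))) => //.
  - under eq_fun do rewrite -big_filter; exact: measurable_prod.
  - by move=> w; apply: prodr_ge0.
  - by apply: fine_ge0; apply: prode_ge0 => i _; apply: integral_ge0 => w _; rewrite lee_fin.
  move=> B mB; rewrite fineK//.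
  (* With factor [i0] replaced by an indicator, all factors from index [k] on are indicators, which
     is the case covered by [IH]. *)
  pose g' i := if i == i0 then \1_B else g i.
  have g'N i : i != i0 -> g' i = g i by rewrite /g' => /negbTE->.
  have g'0 : g' i0 = \1_B by rewrite /g' eqxx.
  have mXB : measurable (X i0 @^-1` B) by exact: measurable_funPTI.
  have := IH g' _ _ _ _; rewrite (bigD1 i0)//= g'0 muleC.
  under eq_integral do rewrite (bigD1 i0)//= g'0.
  under eq_integral do under eq_bigr do rewrite g'N//.
  under eq_bigr do rewrite g'N//.
  apply.
  - by move=> i; rewrite /g'; case: ifP => // _; exact: measurable_indic.
  - by move=> i x; rewrite /g'; case: ifP => // _; rewrite indicE.
  - move=> i; rewrite /g'; case: eqP => // ->.
    by rewrite (@integral_indic _ _ _ P _ _ (X i0 @^-1` B)) ?setIT ?fin_num_measure.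
  - move=> i ki; have [->|ni] := eqVneq i i0; first by exists B.
    rewrite g'N//; apply: gB; rewrite ltn_neqAle ki andbT.
    by apply: contra ni => /eqP ki'; apply/eqP/val_inj.
by apply: (main n) => // i; rewrite leqNgt ltn_ord.
Qed.

(** * The Chernoff bound *)

(** This form separates the exponential moment of the uniform law from the factor due to the
    threshold, as they arise in Chernoff's inequality. It follows from 1 - a^2 = a (b - a) with a =
    exp (- h/2) and b = 1/a. *)
Lemma bound_funE (R : realType) (t h : R) : h != 0 ->
  bound_fun t h = (1 - expR (- h)) / h * expR (- (h * (t - 2^-1))).
Proof.
move=> h0; rewrite /bound_fun (negbTE h0) /sinh.
have -> : - (h * (t - 2^-1)) = - (h * t) + h / 2 by ring.
have -> : - h = - (h / 2) + - (h / 2) by field.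
rewrite !expRD.
have : expR (- (h / 2)) * expR (h / 2) = 1 by rewrite -expRD addNr expR0.
set a := expR (- (h / 2)); set b := expR (h / 2) => ab.
rewrite [RHS](_ : _ = expR (- (h * t)) * (b - a * (a * b)) / h); last by field.
by rewrite ab mulr1; field.
Qed.

Lemma bound_fun_ge0 (R : realType) (t h : R) : 0 <= h -> 0 <= bound_fun t h.
Proof.
move=> h0; have [->|hn0] := eqVneq h 0; first by rewrite /bound_fun eqxx.
rewrite bound_funE// mulr_ge0 ?expR_ge0// divr_ge0//.
by rewrite subr_ge0 -expR0 ler_expR oppr_le0.
Qed.

Lemma measurable_mean_event d (T : measurableType d) (R : realType)
    (P : probability T R) (n : nat) (X : 'I_n -> {RV P >-> R}) (t : R) :
  measurable [set w | t <= 2^-1 - n%:R^-1 * \sum_(i < n) X i w].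
Proof.
rewrite -[X in measurable X]setTI; apply: (measurable_fun_le measurableT) => //.
apply: measurable_funB => //; apply: measurable_funM => //.
exact: measurable_sum.
Qed.

Lemma chernoff_bound_fun d (T : measurableType d) (R : realType)
    (P : probability T R) (n : nat) (X : 'I_n -> {RV P >-> R}) (t h : R) :
  (0 < n)%N -> mutually_independent X -> (forall i, sub_uniform (X i)) -> 0 <= h ->
  (P [set w | (t <= 2^-1 - n%:R^-1 * \sum_(i < n) X i w)%R] <=
   (bound_fun t h ^+ n)%:E)%E.
Proof.
move=> n0 indX subX; rewrite le_eqVlt => /predU1P[<-|h0].
  by rewrite /bound_fun eqxx expr1n probability_le1//; exact: measurable_mean_event.
have hn0 : h != 0 by rewrite gt_eqF.
have nR0 : 0 < n%:R :> R by rewrite ltr0n.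
pose Y w := - \sum_(i < n) X i w.
have mY : measurable_fun setT Y.
  by apply: measurableT_comp => //; apply: measurable_sum.
(* The event reads Y >= a once the mean is multiplied out by [n]. *)
pose a : R := n%:R * (t - 2^-1).
have -> : [set w | t <= 2^-1 - n%:R^-1 * \sum_(i < n) X i w] =
    [set w | a <= (mfun_Sub (mem_set mY) : {RV P >-> R}) w].
  apply/seteqP; split => w /=; rewrite /a /Y -ler_pdivlMl// mulrN.
    by rewrite lerBlDr addrC.
  by rewrite lerBlDr addrC.
apply: le_trans (chernoff _ _ h0) _.
pose b := (1 - expR (- h)) / h.
pose g (_ : 'I_n) (x : R) := expR (- h * x).
have mg i : measurable_fun setT (g i).
  by apply: measurableT_comp => //; apply: mulrl_measurable.
have g0 i x : 0 <= g i x by exact: expR_ge0.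
have gle i : (\int[P]_w (g i (X i w))%:E <= b%:E)%E by exact: sub_uniform_mgf_le.
have gge i : (0 <= \int[P]_w (g i (X i w))%:E)%E.
  by apply: integral_ge0 => w _; rewrite lee_fin.
have gfin i : (\int[P]_w (g i (X i w))%:E)%E \is a fin_num.
  by rewrite ge0_fin_numE// (le_lt_trans (gle i))// ltry.
(* The exponential of [h * Y] is the product of the [g i (X i w)], so independence bounds its
   integral by [n] factors, each at most [b]. *)
have mgf_le : ('M_P (mfun_Sub (mem_set mY)) h <= (b ^+ n)%:E)%E.
  rewrite /mmt_gen_fun unlock.
  rewrite (_ : (\int[P]_w _)%E = (\int[P]_w (\prod_(i < n) g i (X i w))%:E)%E).
    rewrite indep_integral_prod//; under eq_bigr do rewrite -(fineK (gfin _)).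
    rewrite prodEFin lee_fin -[X in _ <= _ ^+ X](card_ord n) -prodr_const.
    apply: ler_prod => i _; rewrite fine_ge0//=.
    by rewrite -lee_fin fineK.
  apply: eq_integral => w _; congr EFin; rewrite -expR_sum /= /Y; congr expR.
  by rewrite -mulr_sumr; ring.
rewrite bound_funE// exprMn -expRM_natl.
have -> : n%:R * - (h * (t - 2^-1)) = - (h * a) by rewrite /a; ring.
by rewrite EFinM lee_wpmul2r// lee_fin expR_ge0.
Qed.

Theorem theorem1 (d : measure_display) (T : measurableType d) (R : realType)
    (P : probability T R) (n : nat) (X : 'I_n -> {RV P >-> R}) (t : R) :
  (0 < n)%N ->
  mutually_independent X ->
  (forall i, sub_uniform (X i)) ->
  0 <= t -> t <= 2^-1 ->
  [/\ (P [set w | (t <= 2^-1 - n%:R^-1 * \sum_(i < n) X i w)%R]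
         <= (inf [set (bound_fun t h ^+ n)%R | h in [set h : R | (0 <= h)%R]])%:E)%E,
      inf [set bound_fun t h ^+ n | h in [set h : R | 0 <= h]]
         <= expR (- (12 * n%:R * t ^+ 2)) * sinhc6 t ^+ n
    & expR (- (12 * n%:R * t ^+ 2)) * sinhc6 t ^+ n
         <= expR (- (6 * n%:R * t ^+ 2))].
Proof.
move=> n0 indX subX t0 _.
have expRX (c : R) : expR (- (c * n%:R * t ^+ 2)) = expR (- (c * t ^+ 2)) ^+ n.
  by rewrite -expRM_natl; congr expR; ring.
split.
- have mE := measurable_mean_event _ _ _ _ _ X t.
  (* The probability is a lower bound of the set, which is nonempty because of h = 0. *)
  rewrite -(fineK (fin_num_measure P _ mE)) lee_fin; apply: lb_le_inf.
    by exists (bound_fun t 0 ^+ n); exists 0 => /=.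
  move=> _ [h /= h0 <-]; rewrite -lee_fin fineK ?fin_num_measure//.
  exact: chernoff_bound_fun.
- (* [h = 12 t] minimizes the upper bound [exp (- h t + h^2 / 24)] of [bound_fun t h]. *)
  have -> : expR (- (12 * n%:R * t ^+ 2)) * sinhc6 t ^+ n = bound_fun t (12 * t) ^+ n.
    rewrite expRX -exprMn; congr (_ ^+ _); rewrite /sinhc6 /bound_fun.
    (* At t = 0 the chosen [h] is also 0, and both conventions give the value 1. *)
    have [->|tn0] := eqVneq t 0; first by rewrite mulr0 eqxx expr0n/= mulr0 oppr0 expR0 mulr1.
    rewrite mulf_eq0 (negbTE tn0) pnatr_eq0/=.
    have -> : 12 * t / 2 = 6 * t by field.
    have -> : 12 * t * t = 12 * t ^+ 2 by ring.
    by field.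
  apply: ge_inf; last by exists (12 * t) => //=; rewrite mulr_ge0.
  (* The infimum lies below a member only for a set bounded below; here 0 is a lower bound. *)
  by exists 0 => _ [h /= h0 <-]; rewrite exprn_ge0// bound_fun_ge0.
- rewrite !expRX -exprMn.
  (* The upper bound is [sinh_le] at x = 6t, where x^2/6 = 6t^2; it absorbs half of the exponent
     -12t^2. *)
  have sinhc0 : 0 <= sinhc6 t <= expR (6 * t ^+ 2).
    rewrite /sinhc6; have [->|tn0] := eqVneq t 0.
      by rewrite expr0n mulr0 expR0 ler01 lexx.
    have t6 : 0 < 6 * t by rewrite mulr_gt0// lt_neqAle eq_sym tn0.
    apply/andP; split.
      apply: divr_ge0 (ltW t6).
      by rewrite /sinh divr_ge0// subr_ge0 ler_expR; lra.
    rewrite ler_pdivrMr// [leRHS]mulrC; have := sinh_le _ _ (ltW t6).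
    by have -> : (6 * t) ^+ 2 / 6 = 6 * t ^+ 2 by field.
  have /andP[s0 sle] := sinhc0.
  rewrite lerXn2r ?nnegrE ?mulr_ge0 ?expR_ge0//.
  have -> : expR (- (6 * t ^+ 2)) = expR (- (12 * t ^+ 2)) * expR (6 * t ^+ 2).
    by rewrite -expRD; congr expR; ring.
  by rewrite ler_wpM2l ?expR_ge0.
Qed.
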